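(* Let $\mathbf A\in G^n$ be an element of type $(h,t)$ and $\mathbf A=\mathbf A_1\mathbf A_2$ its canonical decomposition. For $h\ge1$ write $H(\mathbf A)=H(\mathbf A_1)=\{a_1,\ldots,a_h\}$ and $d_i=\mathrm{ord}(a_i)>1$ for $1\le i\le h$. The following are equivalent: (i) $R_{\mathbf A}$ is free. (ii) $h\in\{0,1\}$, or $h>1$ and the numbers $d_1,\ldots,d_h$ are pairwise coprime. (iii) $N(\mathbf A_1)=0$. (iv) $R_{\mathbf A}$ is isomorphic to $\mathcal A_n$.
   Context: $\mathbb F_q$ is the finite field with $q$ elements, $q$ a power of a prime $p$; $\mathcal A_n=\mathbb F_q[x_1,\ldots,x_n]$, $n\ge1$; $\mathbb N$ contains $0$; $\mathrm{ord}(a)$ is the multiplicative order of $a\in\mathbb F_q^*$. $G\le \mathrm{GL}_2(\mathbb F_q)$ is the group of matrices $\begin{pmatrix}a&b\\0&1\end{pmatrix}$ with $a\ne0$, and $G^n$ is the direct product of $n$ copies. For $\mathbf A=(A_1,\ldots,A_n)\in G^n$, $A_i=\begin{pmatrix}a_i&b_i\\0&1\end{pmatrix}$, and $f\in\mathcal A_n$, $\mathbf A\circ f:=f(a_1x_1+b_1,\ldots,a_nx_n+b_n)$ and $R_{\mathbf A}:=\{f\in\mathcal A_n:\mathbf A\circ f=f\}$. An element of $G$ is of $h$-type if it equals $\begin{pmatrix}a&0\\0&1\end{pmatrix}$ with $a\neq0,1$, and of $t$-type if it equals $\begin{pmatrix}1&1\\0&1\end{pmatrix}$. For nonnegative integers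 $h,t$ with $h+t\le n$, $\mathbf A\in G^n$ is of type $(h,t)$ if its first $h$ coordinates are of $h$-type, the following $t$ are of $t$-type and the remaining $n-h-t$ are the identity matrix. $H(\mathbf A)=\{a_1,\ldots,a_h\}$ is the ordered list (repetitions allowed) of the upper-left entries of the first $h$ coordinates. The canonical decomposition $\mathbf A=\mathbf A_1\mathbf A_2$ is the one in which $\mathbf A_1=(A_1,\ldots,A_h,I,\ldots,I)$ (of type $(h,0)$) and $\mathbf A_2=\mathbf A_1^{-1}\mathbf A$. If $h\ge1$, $M_{\mathbf A_1}$ is the set of monomials $x_1^{b_1}\cdots x_h^{b_h}$ with $(b_1,\ldots,b_h)\in\mathbb N^h$ nonzero, $b_i\le d_i$ for all $i$, and $a_1^{b_1}\cdots a_h^{b_h}=1$; $M_{\mathbf A_1}^*$ is the set of monomials in $M_{\mathbf A_1}$ not divisible by any other element of $M_{\mathbf A_1}$. If $h=0$, $M^*_{\mathbf A_1}=\emptyset$. $N(\mathbf A_1):=|M_{\mathbf A_1}^*|-h$. A finitely generated $\mathbb F_q$-algebra $R\subseteq\mathcal A_n$ is free if it can be generated by a finite set of elements that are algebraically independent over $\mathbb F_q$ (equivalently, it is isomorphic to a polynomial ring over $\mathbb F_q$ in some number $m$ of variables). Isomorphisms are of $\mathbb F_q$-algebras. *)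

(* Defs.v *)
From HB Require Import structures.
From mathcomp Require Import all_boot all_order all_algebra all_fingroup.
From mathcomp Require Export mpoly.

Set Implicit Arguments.
Unset Strict Implicit.
Unset Printing Implicit Defensive.

Import GRing.Theory.
Local Open Scope ring_scope.

Definition aff_mx (F : finFieldType) (a b : F) : 'M[F]_2 :=
  \matrix_(i, j) if i == 0 then (if j == 0 then a else b) else (j == 1)%:R.

Definition aff_set (F : finFieldType) : {set {'GL_2[F]}} :=
  [set g : {'GL_2[F]} |
    [exists a : F, exists b : F, (a != 0) && (@GLval 2 F g == aff_mx a b)]].

Lemma aff_mxM (F : finFieldType) (a b c d : F) :
  aff_mx a b *m aff_mx c d = aff_mx (a * c) (a * d + b).
Proof.
apply/matrixP=> i j; rewrite !mxE !big_ord_recl big_ord0 !mxE /=.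
by case: i => [[|[|//]] ?] /=; case: j => [[|[|//]] ?] /=;
  rewrite ?mul1r ?mul0r ?mulr1 ?mulr0 ?addr0 ?add0r.
Qed.

Lemma aff_mx1 (F : finFieldType) : aff_mx (1 : F) 0 = 1%:M.
Proof.
apply/matrixP=> i j; rewrite !mxE.
by case: i => [[|[|//]] ?] /=; case: j => [[|[|//]] ?] /=.
Qed.

Lemma aff_group_set (F : finFieldType) : group_set (aff_set F).
Proof.
apply/group_setP; split.
  rewrite inE; apply/existsP; exists 1; apply/existsP; exists 0.
  by rewrite oner_eq0 aff_mx1 GL_1E eqxx.
move=> x y; rewrite !inE.
move=> /existsP[a /existsP[b /andP[a0 /eqP xE]]].
move=> /existsP[c /existsP[d /andP[c0 /eqP yE]]].
apply/existsP; exists (a * c); apply/existsP; exists (a * d + b).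
rewrite mulf_neq0 // andTb; apply/eqP.
rewrite -aff_mxM -xE -yE.
exact: GL_MxE.
Qed.
Canonical aff_group (F : finFieldType) := Group (aff_group_set F).

Notation GLpow F n := {dffun forall _ : 'I_n, {'GL_2[F]}}.

Definition aff_pow (F : finFieldType) (n : nat) : {group GLpow F n} :=
  setXn_group (fun _ : 'I_n => aff_group F).

Definition ul (F : finFieldType) (n : nat) (A : GLpow F n) (i : 'I_n) : F :=
  @GLval 2 F (A i) 0 0.

Definition ur (F : finFieldType) (n : nat) (A : GLpow F n) (i : 'I_n) : F :=
  @GLval 2 F (A i) 0 1.

Definition aff_act (F : finFieldType) (n : nat) (A : GLpow F n)
    (f : {mpoly F[n]}) : {mpoly F[n]} :=
  f \mPo [tuple (ul A i)%:MP * 'X_i + (ur A i)%:MP | i < n].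

Definition fixed_ring (F : finFieldType) (n : nat) (A : GLpow F n) :
    {pred {mpoly F[n]}} :=
  [pred f | aff_act A f == f].

Lemma fixed_ring_subalg (F : finFieldType) (n : nat) (A : GLpow F n) :
  GRing.subalg_closed (fixed_ring A).
Proof.
split=> [|a u v|u v]; rewrite !inE /aff_act ?rmorph1 //.
  by move=> /eqP uE /eqP vE; rewrite comp_mpolyD comp_mpolyZ uE vE.
by move=> /eqP uE /eqP vE; rewrite rmorphM /= uE vE.
Qed.

HB.instance Definition _ (F : finFieldType) (n : nat) (A : GLpow F n) :=
  GRing.isSubalgClosed.Build F {mpoly F[n]} (fixed_ring A)
    (fixed_ring_subalg A).

(* [fixed_ring A] as an [F]-algebra in its own right. *)
Record fixed_alg (F : finFieldType) (n : nat) (A : GLpow F n) := FixedAlg {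
  fixed_val : {mpoly F[n]};
  fixed_valP : fixed_val \in fixed_ring A
}.

Section FixedAlgebra.
Variables (F : finFieldType) (n : nat) (A : GLpow F n).

HB.instance Definition _ := [isSub for @fixed_val F n A].
HB.instance Definition _ := [Choice of fixed_alg A by <:].
HB.instance Definition _ := [SubChoice_isSubComNzRing of fixed_alg A by <:].
HB.instance Definition _ := [SubZmodule_isSubLmodule of fixed_alg A by <:].
HB.instance Definition _ :=
  [SubNzRing_SubLmodule_isSubLalgebra of fixed_alg A by <:].
HB.instance Definition _ := [SubLalgebra_isSubAlgebra of fixed_alg A by <:].

End FixedAlgebra.

Definition alg_isomorphic (F : fieldType) (R S : algType F) : Prop :=
  exists phi : {lrmorphism R -> S}, bijective phi.

Definition alg_independent (F : fieldType) (n m : nat)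
    (s : m.-tuple {mpoly F[n]}) : Prop :=
  forall p : {mpoly F[m]}, p \mPo s = 0 -> p = 0.

Definition generates (F : fieldType) (n m : nat) (s : m.-tuple {mpoly F[n]})
    (R : {pred {mpoly F[n]}}) : Prop :=
  forall f : {mpoly F[n]}, f \in R <-> exists p : {mpoly F[m]}, f = p \mPo s.

Definition is_free (F : fieldType) (n : nat) (R : {pred {mpoly F[n]}}) : Prop :=
  exists (m : nat) (s : m.-tuple {mpoly F[n]}), alg_independent s /\ generates s R.

Definition h_type (F : finFieldType) (g : {'GL_2[F]}) : Prop :=
  exists a : F, [/\ a != 0, a != 1 & @GLval 2 F g = aff_mx a 0].

Definition t_type (F : finFieldType) (g : {'GL_2[F]}) : Prop :=
  @GLval 2 F g = aff_mx 1 1.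

(* Coordinates are indexed from 0. *)
Definition has_type (F : finFieldType) (n : nat) (A : GLpow F n) (h t : nat) : Prop :=
  (h + t <= n)%N /\
  forall i : 'I_n,
    [/\ (i < h)%N -> h_type (A i),
        (h <= i < h + t)%N -> t_type (A i)
      & (h + t <= i)%N -> A i = 1%g].

Definition canonical_decomposition (F : finFieldType) (n : nat)
    (A : GLpow F n) (h : nat) (A1 A2 : GLpow F n) : Prop :=
  A1 = [ffun i : 'I_n => if (i < h)%N then A i else 1%g] /\ A2 = (A1^-1 * A)%g.

(* [insubd] falls back to the unit [1] at the irrelevant value [a = 0]. *)
Definition mul_order (F : finFieldType) (a : F) : nat :=
  #[insubd (1%g : {unit F}) a]%g.

Definition ord_ul (F : finFieldType) (n : nat) (A : GLpow F n) (i : 'I_n) : nat :=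
  mul_order (ul A i).

Definition in_M (F : finFieldType) (n : nat) (A : GLpow F n) (h : nat)
    (m : 'X_{1..n}) : bool :=
  [&& m != 0%MM,
      [forall i : 'I_n, m i <= (if i < h then ord_ul A i else 0)]%N
    & \prod_(i < n | (i < h)%N) ul A i ^+ m i == 1].

Definition M_bound (F : finFieldType) (n : nat) (A : GLpow F n) (h : nat) : nat :=
  (\sum_(i < n | (i < h)%N) ord_ul A i).+1.

(* The degree bound only serves to make the ambient monomial type finite; it
   excludes no monomial satisfying [in_M]. *)
Lemma in_M_bound (F : finFieldType) (n : nat) (A : GLpow F n) (h : nat)
    (m : 'X_{1..n}) :
  in_M A h m -> (mdeg m < M_bound A h)%N.
Proof.
case/and3P=> _ /forallP le_m _; rewrite /M_bound ltnS mdegE big_mkcond.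
by rewrite [leqRHS]big_mkcond /= leq_sum.
Qed.

Definition M_set (F : finFieldType) (n : nat) (A : GLpow F n) (h : nat) :
    {set 'X_{1..n < M_bound A h}} :=
  [set m : 'X_{1..n < M_bound A h} | in_M A h m].

(* For [h = 0] the set is empty, see [M_star0]. *)
Definition M_star (F : finFieldType) (n : nat) (A : GLpow F n) (h : nat) :
    {set 'X_{1..n < M_bound A h}} :=
  [set m in M_set A h |
    ~~ [exists m' in M_set A h, (m' != m) && (bmnm m' <= bmnm m)%MM]].

Lemma M_star0 (F : finFieldType) (n : nat) (A : GLpow F n) : M_star A 0 = set0.
Proof.
apply/setP=> m; rewrite !inE /in_M; apply/negbTE/negP=> /andP[/and3P[+ /forallP m0 _] _].
by case/eqP; apply/mnmP=> i; apply/eqP; rewrite mnmE -leqn0 m0.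
Qed.

Definition N_num (F : finFieldType) (n : nat) (A1 : GLpow F n) (h : nat) : int :=
  (#|M_star A1 h|)%:Z - h%:Z.

(* Main.v *)
Require Import Defs.
From HB Require Import structures.
From mathcomp Require Import all_boot all_order all_algebra all_fingroup.
From mathcomp Require Import finfield zify ring.

(* Write [R] for the fixed ring and call a monomial invariant if the homotheties
   fix it. Every monomial of an element of [R] is invariant, so the invariant
   monomials that are not products of smaller ones (atoms) survive modulo the
   square of the augmentation ideal of [R]: each [x_i ^ d_i] is one, with
   [d_i = 1] for the coordinates that are not homotheties, and there is one more
   as soon as two of the [d_i] have a common factor. Then [R] needs at least
   [n + 1] generators, while at most [n] polynomials are algebraically
   independent. If the [d_i] are pairwise coprime, a change of variables leaves
   at most one translated variable, and the iterates of [A] then act on each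
   variable separately; the invariants [x ^ d_i] of the scaled variables and
   [x ^ p - x] of the translated one are [n] algebraically independent
   generators. *)

Set Implicit Arguments.
Unset Strict Implicit.
Unset Printing Implicit Defensive.

Import GRing.Theory.
Local Open Scope ring_scope.

(** * Substitution of polynomials into polynomials *)

Lemma comp_mpolyXt (R : comNzRingType) (n m : nat)
    (s : n.-tuple {mpoly R[m]}) (i : 'I_n) : 'X_i \mPo s = tnth s i.
Proof. by rewrite comp_mpolyXU -tnth_nth. Qed.

Lemma comp_mpoly_prodX (R : comNzRingType) (n m : nat)
    (s : n.-tuple {mpoly R[m]}) (p : {mpoly R[n]}) :
  p \mPo s = \sum_(k <- msupp p) p@_k *: \prod_i tnth s i ^+ k i.
Proof.
rewrite [in LHS](mpolyE p) raddf_sum /=.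
by apply: eq_bigr => k _; rewrite comp_mpolyZ comp_mpolyX.
Qed.

Lemma rmorph_comp_mpoly (R : comNzRingType) (n m : nat)
    (S : comAlgType R) (g : {lrmorphism {mpoly R[m]} -> S})
    (g' : {lrmorphism {mpoly R[n]} -> S}) (s : n.-tuple {mpoly R[m]}) :
  (forall i, g (tnth s i) = g' 'X_i) -> forall p, g (p \mPo s) = g' p.
Proof.
move=> gE p; rewrite comp_mpoly_prodX raddf_sum [in RHS](mpolyE p) raddf_sum /=.
apply: eq_bigr => k _; rewrite !linearZ /= mpolyXE_id !rmorph_prod /=.
by congr (_ *: _); apply: eq_bigr => i _; rewrite !rmorphXn /= gE.
Qed.

Lemma comp_mpolyA (R : comNzRingType) (n m k : nat) (s : n.-tuple {mpoly R[m]})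
    (u : m.-tuple {mpoly R[k]}) (p : {mpoly R[n]}) :
  (p \mPo s) \mPo u = p \mPo [tuple tnth s i \mPo u | i < n].
Proof.
apply: (rmorph_comp_mpoly (g := comp_mpoly u)
  (g' := comp_mpoly [tuple tnth s i \mPo u | i < n])) => i /=.
by rewrite comp_mpolyXt tnth_mktuple.
Qed.

Lemma eq_comp_mpoly (R : comNzRingType) (n m : nat)
    (s u : n.-tuple {mpoly R[m]}) :
  tnth s =1 tnth u -> comp_mpoly s =1 comp_mpoly u.
Proof. by move=> /eq_from_tnth->. Qed.

(** * Degree bounds, and bounds on the numbers of independent polynomials and of generators *)

Lemma msize_prod_le (R : idomainType) (n : nat) (I : Type) (r : seq I)
    (f : I -> {mpoly R[n]}) (D : I -> nat) :
  (forall i, (msize (f i) <= (D i).+1)%N) ->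
  (msize (\prod_(i <- r) f i) <= (\sum_(i <- r) D i).+1)%N.
Proof.
move=> fD; elim: r => [|x r IH]; first by rewrite !big_nil msize1.
rewrite !big_cons; have [->|f0] := eqVneq (f x) 0; first by rewrite mul0r msize0.
have [->|g0] := eqVneq (\prod_(i <- r) f i) 0; first by rewrite mulr0 msize0.
rewrite msizeM //.
by have := fD x; lia.
Qed.

Lemma msizeX_le (R : idomainType) (n k D : nat) (f : {mpoly R[n]}) :
  (msize f <= D.+1)%N -> (msize (f ^+ k) <= (k * D).+1)%N.
Proof.
move=> fD; have := @msize_prod_le R n _ (index_enum 'I_k) (fun=> f) (fun=> D).
by rewrite !big_const_ord iter_mulr_1 iter_addn_0 mulnC => /(_ (fun=> fD)).
Qed.

(* Counting: the [q ^ (N ^ m)] polynomials whose exponents are all below [N]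
   are mapped injectively to polynomials of degree [O(N)] in [n] variables, so
   that [N ^ m = O(N ^ n)]. *)
Lemma alg_independent_leq (F : finFieldType) (n m : nat)
    (s : m.-tuple {mpoly F[n]}) : alg_independent s -> (m <= n)%N.
Proof.
move=> sI; pose D := \max_i msize (tnth s i).
have sD i : (msize (tnth s i) <= D.+1)%N.
  exact/(leq_trans _ (leqnSn _))/(leq_bigmax (F := fun i => msize (tnth s i))).
(* [m * (N * D)] bounds the degree after substituting [s] into a polynomial with exponents below
   [N]; one is added since [msize] exceeds the degree by one. *)
pose K N := (m * (N * D)).+1.
have bound N : (0 < N -> N ^ m <= K N ^ n)%N.
  case: N => // N _.
  pose B := {ffun 'I_m -> 'I_N.+1}; pose B' := {ffun 'I_n -> 'I_(K N.+1)}.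
  pose mo (e : B) : 'X_{1..m} := [multinom (e i : nat) | i < m].
  have moI : injective mo.
    move=> e e' /mnmP eq_e; apply/ffunP=> i; apply/val_inj.
    by have := eq_e i; rewrite !mnmE.
  pose P (g : {ffun B -> F}) : {mpoly F[m]} := \sum_e g e *: 'X_[mo e].
  have PE g e : (P g)@_(mo e) = g e.
    rewrite /P raddf_sum (bigD1 e) //= mcoeffZ mcoeffX eqxx mulr1 big1 ?addr0 //.
    move=> e' ne; rewrite mcoeffZ mcoeffX; case: eqP => [/moI eq_e|]; last first.
      by rewrite mulr0.
    by rewrite eq_e eqxx in ne.
  (* By the degree bound [size_P], keeping only exponents below [K N.+1] loses nothing on the
     images. *)
  pose c (f : {mpoly F[n]}) : {ffun B' -> F} :=
    [ffun e : B' => f@_[multinom (e i : nat) | i < n]].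
  have size_P g : (msize (P g \mPo s) <= K N.+1)%N.
    rewrite /P raddf_sum /=; apply: (leq_trans (msize_sum _ _ _)).
    apply/bigmax_leqP => e _; rewrite comp_mpolyZ.
    apply: (leq_trans (msizeZ_le _ _)); rewrite comp_mpolyX /K.
    have /(_ (index_enum 'I_m)) := @msize_prod_le F n _ _
      (fun i => tnth s i ^+ mo e i) (fun=> (N.+1 * D)%N).
    rewrite big_const_ord iter_addn_0 [(_ * m)%N]mulnC; apply=> i.
    apply: (leq_trans (msizeX_le (mo e i) (sD i))); rewrite ltnS leq_mul2r.
    by rewrite mnmE (ltnW (ltn_ord _)) orbT.
  have cI : injective (fun g => c (P g \mPo s)).
    move=> g g' /ffunP cE.
    suff PP : P g = P g' by apply/ffunP=> e; rewrite -!PE PP.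
    apply/eqP; rewrite -subr_eq0; apply/eqP/sI; rewrite linearB /=.
    apply/eqP; rewrite subr_eq0; apply/eqP/mpolyP => k.
    have [/forallP k_lt|/forallPn[i]] := boolP [forall i, k i < K N.+1]%N.
      have := cE [ffun i => Ordinal (k_lt i)]; rewrite !ffunE.
      suff -> : [multinom ([ffun i => Ordinal (k_lt i)] i : nat) | i < n] = k by [].
      by apply/mnmP=> i; rewrite mnmE ffunE.
    rewrite -leqNgt => k_ge.
    have le_k : (K N.+1 <= mdeg k)%N.
      by rewrite (leq_trans k_ge) // mdegE (bigD1 i) //= leq_addr.
    rewrite !memN_msupp_eq0 //; apply: msize_mdeg_ge;
      exact: leq_trans (size_P _) le_k.
  have := leq_card _ cI; rewrite !card_ffun !card_ord.
  by rewrite leq_exp2l // card_finNzRing_gt1.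
rewrite leqNgt; apply/negP => lt_nm.
(* [K N <= C * N] for positive [N], and [N > C ^ n] makes [N ^ n.+1] exceed [(C * N) ^ n]. *)
pose C := (m * D).+1; pose N := (C ^ n).+1.
have : (N ^ m <= (C * N) ^ n)%N.
  apply: leq_trans (bound N isT) _; case: (n) => // n'; rewrite leq_exp2r //.
  by rewrite /K /C mulSn mulnCA mulnC; lia.
rewrite expnMn leqNgt => /negP; apply.
apply: leq_trans (leq_pexp2l _ lt_nm) => //.
by rewrite expnS ltn_pmul2r ?expn_gt0.
Qed.

(* If [s] generates [R], then on the augmentation ideal of [R] modulo its
   square the coefficient functionals at the monomials [mu j] are linear in the
   images of the [m] generators; being dual to the [e i] they are independent. *)
Lemma generates_card_leq (F : fieldType) (n m : nat)
    (s : m.-tuple {mpoly F[n]}) (R : {pred {mpoly F[n]}}) (T : finType)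
    (mu : T -> 'X_{1..n}) (e : T -> {mpoly F[n]}) :
  generates s R -> (forall i, e i \in R) ->
  (forall i j, (e i)@_(mu j) = (i == j)%:R) ->
  (forall j, mu j != 0%MM) ->
  (forall j f m1 m2, f \in R -> mu j = (m1 + m2)%MM ->
     m1 != 0%MM -> m2 != 0%MM -> f@_m1 = 0) ->
  (#|T| <= m)%N.
Proof.
move=> sR eR e_dual mu0 mu_prim.
pose L j (f : {mpoly F[n]}) := f@_(mu j).
(* A Leibniz rule: the product of the parts without constant term has coefficient 0 at [mu j], since
   a splitting of [mu j] into nonzero monomials has its first factor outside the support of [f]. *)
have LM j f g : f \in R -> L j (f * g) = f@_0 * L j g + L j f * g@_0.
  move=> fR; rewrite /L.
  have supp0 (k : {mpoly F[n]}) m0 :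
      m0 \in msupp (k - (k@_0)%:MP) -> m0 != 0%MM /\ k@_m0 != 0.
    rewrite mcoeff_msupp mcoeffB mcoeffC; have [->|m0_neq0] := eqVneq m0 0%MM.
      by rewrite mulr1 subrr eqxx.
    by rewrite mulr0 subr0.
  have fgE : f * g = f@_0 *: g + g@_0 *: (f - (f@_0)%:MP)
                     + (f - (f@_0)%:MP) * (g - (g@_0)%:MP).
    by rewrite -!mul_mpolyC; ring.
  have Lf : (f - (f@_0)%:MP)@_(mu j) = f@_(mu j).
    by rewrite mcoeffB mcoeffC (negPf (mu0 j)) mulr0 subr0.
  rewrite [in LHS]fgE !mcoeffD !mcoeffZ Lf [_@_0 * f@__]mulrC -[RHS]addr0.
  congr (_ + _); apply: memN_msupp_eq0.
  apply/negP=> /msuppM_le /allpairsP[[m1 m2] /= [/supp0[m1_0 fm1] /supp0[m2_0 _]]].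
  by move=> muE; rewrite (mu_prim _ _ _ _ fR muE) ?eqxx in fm1.
pose lin f := exists c : 'I_m -> F, forall j, L j f = \sum_k c k * L j (tnth s k).
have comp_s p : p \mPo s \in R by apply/sR; exists p.
have linD f g : lin f -> lin g -> lin (f + g).
  move=> [c cE] [d dE]; exists (fun k => c k + d k) => j.
  rewrite /L mcoeffD -!/(L _ _) cE dE -big_split /=.
  by apply: eq_bigr => k _; rewrite mulrDl.
have linZ a f : lin f -> lin (a *: f).
  move=> [c cE]; exists (fun k => a * c k) => j.
  rewrite /L mcoeffZ -!/(L _ _) cE mulr_sumr.
  by apply: eq_bigr => k _; rewrite mulrA.
have linX i : lin (tnth s i).
  exists (fun k => (k == i)%:R) => j; rewrite (bigD1 i) //= eqxx mul1r.
  by rewrite big1 ?addr0 // => k /negPf->; rewrite mul0r.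
have linM p q : lin (p \mPo s) -> lin (q \mPo s) -> lin ((p * q) \mPo s).
  move=> lp lq; have := linD _ _ (linZ (q \mPo s)@_0 _ lp) (linZ (p \mPo s)@_0 _ lq).
  move=> [c cE]; exists c => j; rewrite -cE rmorphM /= LM //.
  by rewrite /L mcoeffD !mcoeffZ; ring.
have lin0 : lin 0.
  exists (fun=> 0) => j; rewrite /L mcoeff0 big1 // => k _; exact: mul0r.
have lin1 : lin 1.
  exists (fun=> 0) => j; rewrite /L mcoeff1 (negPf (mu0 j)) big1 // => k _.
  exact: mul0r.
have lin_s p : lin (p \mPo s).
  rewrite (mpolyE p) raddf_sum /=; elim/big_rec: _ => // k f _ lf.
  apply: linD => //; rewrite comp_mpolyZ; apply: linZ.
  rewrite mpolyXE_id; elim/big_rec: _ => [|i q _ lq]; first by rewrite comp_mpoly1.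
  apply: (linM) lq; elim: (k i) => [|d IH]; first by rewrite expr0 comp_mpoly1.
  by rewrite exprS; apply: (linM) IH; rewrite comp_mpolyXt.
have /fin_all_exists[c cE] i :
    exists c : 'I_m -> F, forall j, (e i)@_(mu j) = \sum_k c k * L j (tnth s k).
  by have /sR[p ->] := eR i; apply: lin_s.
(* The identity matrix of size [#|T|] factors through dimension [m]. *)
pose B : 'M[F]_(#|T|, m) := \matrix_(i, k) c (enum_val i) k.
pose C : 'M[F]_(m, #|T|) := \matrix_(k, j) L (enum_val j) (tnth s k).
suff /mulmx1_min : B *m C = 1%:M by [].
apply/matrixP=> i j; rewrite !mxE -(inj_eq enum_val_inj) -e_dual cE.
by apply: eq_bigr => k _; rewrite !mxE.
Qed.

(** * Multiplicative orders and the shape of the coordinates of [A] *)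

Lemma mul_order_prim (F : finFieldType) (a : F) :
  a != 0 -> (mul_order a).-primitive_root a.
Proof.
move=> a0; rewrite /mul_order; set u := insubd _ a.
have uE : FinRing.uval u = a by rewrite val_insubd unitfE a0.
apply/andP; split; first exact: order_gt0.
apply/forallP=> i; apply/eqP; rewrite unity_rootE -{1}uE.
have -> : (FinRing.uval u ^+ i.+1 == 1) = (#[u]%g %| i.+1)%N.
  by rewrite cyclic.order_dvdn -val_eqE /= FinRing.val_unitX.
apply/idP/eqP=> [u_dvd|->//].
by apply/eqP; rewrite eqn_leq ltn_ord (dvdn_leq _ u_dvd).
Qed.

Lemma mul_order_dvd (F : finFieldType) (a : F) (k : nat) :
  a != 0 -> (mul_order a %| k)%N = (a ^+ k == 1).
Proof. by move=> a0; rewrite (prim_order_dvd (mul_order_prim a0)). Qed.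

Lemma mul_order_gt0 (F : finFieldType) (a : F) : (0 < mul_order a)%N.
Proof. exact: order_gt0. Qed.

Lemma mul_order1 (F : finFieldType) : mul_order (1 : F) = 1%N.
Proof. by apply/eqP; rewrite -dvdn1 mul_order_dvd ?oner_eq0 // expr1. Qed.

Lemma natr_card (F : finFieldType) : #|F|%:R = 0 :> F.
Proof. by rewrite -FinRing.zmodXgE -cardsT cyclic.expg_cardG ?inE. Qed.

(** Forgets the order of the coordinates: each is a homothety, possibly trivial, or the translation
    by 1. *)
Definition reduced_type (F : finFieldType) (n : nat) (A : GLpow F n) : Prop :=
  forall i, ul A i != 0 /\ (ur A i = 0 \/ ul A i = 1 /\ ur A i = 1).

Lemma has_type_reduced (F : finFieldType) (n : nat) (A : GLpow F n) (h t : nat) :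
  has_type A h t ->
  reduced_type A /\ forall i : 'I_n, (i < h)%N = (ul A i != 1).
Proof.
case=> _ A_type.
suff H (i : 'I_n) : [/\ ul A i != 0, ur A i = 0 \/ ul A i = 1 /\ ur A i = 1
    & (i < h)%N = (ul A i != 1)].
  by split=> i; have [] := H i.
have [Ah At A1] := A_type i; rewrite /ul /ur.
have [lt_ih|le_hi] := ltnP i h.
  have [a [a0 a1 ->]] := Ah lt_ih; rewrite !mxE /=.
  by split=> //; left.
have [lt_it|le_ti] := ltnP i (h + t).
  have := At; rewrite le_hi lt_it /t_type => /(_ isT) ->.
  by rewrite !mxE /= oner_eq0 eqxx; split=> //; right.
by rewrite A1 // GL_1E !mxE /= oner_eq0 eqxx; split=> //; left.
Qed.

(** * Iterates of the action and characters of monomials *)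

Lemma iter_aff_act (F : finFieldType) (n : nat) (A : GLpow F n) (k : nat)
    (f : {mpoly F[n]}) : reduced_type A ->
  iter k (aff_act A) f =
    f \mPo [tuple (ul A i ^+ k)%:MP * 'X_i + (ur A i *+ k)%:MP | i < n].
Proof.
move=> A_red; elim: k => [|k IH] /=.
  rewrite -[LHS]comp_mpoly_id; apply: eq_comp_mpoly => i.
  by rewrite !tnth_mktuple expr0 mpolyC1 mul1r mulr0n mpolyC0 addr0.
rewrite IH /aff_act comp_mpolyA; apply: eq_comp_mpoly => i.
rewrite !tnth_mktuple comp_mpolyD rmorphM /= !comp_mpolyC comp_mpolyXt.
rewrite tnth_mktuple mulrDr mulrA -!mpolyCM -addrA -mpolyCD exprSr mulrS.
(* No coordinate both scales and translates, so the translations simply add up. *)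
by have [_ [->|[-> ->]]] := A_red i; rewrite ?mulr0 ?mul0rn ?expr1n ?mul1r.
Qed.

Lemma fixed_ringP (F : finFieldType) (n : nat) (A : GLpow F n)
    (f : {mpoly F[n]}) : reflect (aff_act A f = f) (f \in fixed_ring A).
Proof. exact: eqP. Qed.

(** The eigenvalue of the homothety part of [A] on the monomial [m]. *)
Definition mon_char (F : finFieldType) (n : nat) (A : GLpow F n)
    (m : 'X_{1..n}) : F := \prod_i ul A i ^+ m i.

Lemma mon_charD (F : finFieldType) (n : nat) (A : GLpow F n) (m1 m2 : 'X_{1..n}) :
  mon_char A (m1 + m2) = mon_char A m1 * mon_char A m2.
Proof.
by rewrite -big_split; apply: eq_bigr => i _; rewrite mnmDE exprD.
Qed.

Lemma mon_char_mulm1 (F : finFieldType) (n : nat) (A : GLpow F n) (i : 'I_n) k :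
  mon_char A (U_(i) *+ k)%MM = ul A i ^+ k.
Proof.
rewrite /mon_char (bigD1 i) //= mulmnE mnm1E eqxx mul1n big1 ?mulr1 // => j ne_ji.
by rewrite mulmnE mnm1E eq_sym (negPf ne_ji).
Qed.

Lemma comp_mpoly_diag (R : comNzRingType) (n : nat) (a : 'I_n -> R)
    (f : {mpoly R[n]}) (m : 'X_{1..n}) :
  (f \mPo [tuple (a i)%:MP * 'X_i | i < n])@_m = (\prod_i a i ^+ m i) * f@_m.
Proof.
rewrite comp_mpoly_prodX raddf_sum [in RHS](mpolyE f) raddf_sum mulr_sumr /=.
apply: eq_bigr => k _; rewrite !mcoeffZ.
have -> : \prod_i tnth [tuple (a i)%:MP * 'X_i | i < n] i ^+ k i
    = (\prod_i a i ^+ k i) *: 'X_[k].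
  rewrite -mul_mpolyC mpolyXE_id rmorph_prod -big_split /=.
  by apply: eq_bigr => i _; rewrite tnth_mktuple exprMn rmorphXn.
rewrite mcoeffZ mcoeffX; case: eqP => [->|_]; last by rewrite !mulr0.
by rewrite !mulr1 mulrC.
Qed.

(* The [#|F|]-th iterate of the action kills the translations and keeps the
   homotheties, since [a ^+ #|F| = a]. *)
Lemma fixed_ring_mon_char (F : finFieldType) (n : nat) (A : GLpow F n)
    (f : {mpoly F[n]}) (m : 'X_{1..n}) : reduced_type A ->
  f \in fixed_ring A -> f@_m != 0 -> mon_char A m = 1.
Proof.
move=> A_red /fixed_ringP fE fm.
have : iter #|F| (aff_act A) f = f by elim: #|F| => //= k ->.
rewrite iter_aff_act // => /(congr1 (mcoeff m)).
rewrite (@eq_comp_mpoly _ _ _ _ [tuple (ul A i)%:MP * 'X_i | i < n]); last first.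
  move=> i; rewrite !tnth_mktuple expf_card -[ur A i *+ _]mulr_natr natr_card.
  by rewrite mulr0 mpolyC0 addr0.
by rewrite comp_mpoly_diag -[RHS]mul1r => /(mulIf fm).
Qed.

(** * Atoms among the invariant monomials, and the necessity of coprime orders *)

Definition pairwise_coprime_orders (F : finFieldType) (n : nat) (A : GLpow F n) :
    Prop := forall i j : 'I_n, i <> j -> coprime (ord_ul A i) (ord_ul A j).

(** A condition on [m1] suffices: the character is multiplicative and trivial on [m], so [m1] and
    [m2] are invariant together. *)
Definition atom (F : finFieldType) (n : nat) (A : GLpow F n)
    (m : 'X_{1..n}) : Prop :=
  [/\ m != 0%MM, mon_char A m = 1
    & forall m1 m2, m = (m1 + m2)%MM -> m1 != 0%MM -> m2 != 0%MM ->
        mon_char A m1 != 1].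

(** At a translated or trivial coordinate the order is 1 and this is [x_i] itself. *)
Definition pure_atom (F : finFieldType) (n : nat) (A : GLpow F n)
    (i : 'I_n) : 'X_{1..n} := (U_(i) *+ ord_ul A i)%MM.

Lemma pure_atomE (F : finFieldType) (n : nat) (A : GLpow F n) (i j : 'I_n) :
  pure_atom A i j = if i == j then ord_ul A i else 0%N.
Proof. by rewrite mulmnE mnm1E; case: eqP => _; rewrite ?mul1n ?mul0n. Qed.

Lemma pure_atom_inj (F : finFieldType) (n : nat) (A : GLpow F n) :
  injective (pure_atom A).
Proof.
move=> i j /mnmP/(_ i); rewrite !pure_atomE eqxx; case: eqP => // _ o0.
by have := mul_order_gt0 (ul A i); rewrite -/(ord_ul A i) o0.
Qed.

Lemma mon_char_pure_atom (F : finFieldType) (n : nat) (A : GLpow F n) (i : 'I_n) :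
  ul A i != 0 -> mon_char A (pure_atom A i) = 1.
Proof. by move=> a0; apply/eqP; rewrite mon_char_mulm1 -mul_order_dvd. Qed.

(** A proper factor is a power of [x_i] with a positive exponent below the order, so its character
    is not 1. *)
Lemma atom_pure (F : finFieldType) (n : nat) (A : GLpow F n) (i : 'I_n) :
  ul A i != 0 -> atom A (pure_atom A i).
Proof.
move=> a0; split; last first.
- move=> m1 m2 /mnmP mE m1_0 m2_0.
  have m1E : m1 = (U_(i) *+ m1 i)%MM.
    apply/mnmP=> j; have := mE j.
    rewrite pure_atomE mulmnE mnm1E mnmDE; case: eqP => [->|_ /esym/eqP].
      by rewrite mul1n.
    by rewrite addn_eq0 mul0n => /andP[/eqP].
  have m2i : (0 < m2 i)%N.
    rewrite lt0n; apply: contraNneq m2_0 => m2i; apply/eqP/mnmP=> j.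
    rewrite mnm0E; have := mE j; rewrite pure_atomE mnmDE.
    case: eqP => [<- _ //|_ /esym/eqP]; by rewrite addn_eq0 => /andP[_ /eqP].
  have m1i : (0 < m1 i)%N.
    by rewrite lt0n; apply: contraNneq m1_0 => m1i; rewrite m1E m1i mulm0n.
  rewrite m1E mon_char_mulm1 -mul_order_dvd // gtnNdvd //.
  by have := mE i; rewrite pure_atomE eqxx mnmDE /ord_ul => ->; lia.
- exact: mon_char_pure_atom.
- rewrite -mdeg_eq0 mdegMn mdeg1 mul1n -lt0n; exact: mul_order_gt0.
Qed.

(* Two cyclic subgroups of [F^*] whose orders share a factor [g > 1] share a
   subgroup of order [g]; this gives an invariant monomial in two variables that
   is not a product of the pure ones, and one of minimal degree is an atom. *)
Lemma exists_mixed_atom (F : finFieldType) (n : nat) (A : GLpow F n)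
    (i j : 'I_n) : (forall k, ul A k != 0) ->
  i != j -> ~~ coprime (ord_ul A i) (ord_ul A j) ->
  exists m, atom A m /\ forall k, m != pure_atom A k.
Proof.
move=> a0 ne_ij not_cop.
(* Divisibility of the [i]-th exponent is additive, so splitting a bad monomial into invariant
   factors leaves a bad factor; one of least degree therefore has no nontrivial such splitting. *)
pose bad (m : 'X_{1..n}) := (mon_char A m == 1) && ~~ (ord_ul A i %| m i)%N.
pose P d := [exists m : 'X_{1..n < d.+1}, bad m].
have badP m : bad m -> P (mdeg m).
  by move=> bm; apply/existsP; exists (BMultinom (leqnn (mdeg m).+1)).
have [|d /existsP[m bad_m] d_min] := @ex_minnP P.
  pose g := gcdn (ord_ul A i) (ord_ul A j).
  have g1 : (1 < g)%N.
    by rewrite ltn_neqAle eq_sym not_cop gcdn_gt0 mul_order_gt0.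
  pose x := ul A i ^+ (ord_ul A i %/ g); pose y := ul A j ^+ (ord_ul A j %/ g).
  have xP : g.-primitive_root x.
    exact: (dvdn_prim_root (mul_order_prim (a0 i)) (dvdn_gcdl _ _)).
  have yP : g.-primitive_root y.
    exact: (dvdn_prim_root (mul_order_prim (a0 j)) (dvdn_gcdr _ _)).
  (* It follows that [x = y ^ k] contributes [x] to the character through the exponent [b1], and
     [x ^ g.-1] through [b2], for a total of [x ^ g = 1]. *)
  have [k xk] := prim_rootP yP (prim_expr_order xP).
  pose b1 := (ord_ul A i %/ g)%N; pose b2 := (ord_ul A j %/ g * (k * g.-1))%N.
  pose m := (U_(i) *+ b1 + U_(j) *+ b2)%MM.
  exists (mdeg m); apply: badP; apply/andP; split.
    rewrite mon_charD !mon_char_mulm1 exprM -/x -/y exprM -xk -exprS prednK.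
      by rewrite (prim_expr_order xP).
    exact: ltnW.
  have -> : m i = b1.
    by rewrite mnmDE !mulmnE !mnm1E eqxx [j == i]eq_sym (negPf ne_ij) mul1n addn0.
  have b1_gt0 : (0 < b1)%N.
    by rewrite divn_gt0 ?(ltnW g1) // dvdn_leq ?dvdn_gcdl ?mul_order_gt0.
  rewrite gtnNdvd // ltn_Pdiv ?mul_order_gt0 //.
case/andP: (bad_m) => /eqP chi_m ndvd_m; exists (m : 'X_{1..n}); split; last first.
  move=> k; apply: contraNneq ndvd_m => ->; rewrite pure_atomE.
  by case: eqP => [->|_]; rewrite ?dvdnn ?dvdn0.
have min_m m1 : bad m1 -> (mdeg m <= mdeg m1)%N.
  by move=> /badP /d_min; apply: leq_trans; rewrite -ltnS bmdeg.
split=> //; first by apply: contraNneq ndvd_m => ->; rewrite mnm0E dvdn0.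
move=> m1 m2 mE m1_0 m2_0; apply/negP => /eqP chi_m1.
have chi_m2 : mon_char A m2 = 1 by rewrite mE mon_charD chi_m1 mul1r in chi_m.
have degE : mdeg m = (mdeg m1 + mdeg m2)%N by rewrite mE mdegD.
move: m1_0 m2_0; rewrite -!mdeg_eq0 -!lt0n => m1_0 m2_0.
have [d1|nd1] := boolP (ord_ul A i %| m1 i)%N; last first.
  have := min_m m1; rewrite /bad chi_m1 eqxx nd1 => /(_ isT); lia.
have := min_m m2; rewrite /bad chi_m2 eqxx -(dvdn_addr _ d1) -mnmDE -mE ndvd_m.
move=> /(_ isT); lia.
Qed.

(** A higher power would split off the invariant factor [x_i]. This shows that [x_i ^ p] is not an
    atom at a translated coordinate. *)
Lemma atom_U_eq1 (F : finFieldType) (n : nat) (A : GLpow F n) (i : 'I_n) (k : nat) :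
  ul A i = 1 -> atom A (U_(i) *+ k)%MM -> k = 1%N.
Proof.
move=> ai [m0 _ m_prim].
case: k m0 m_prim => [|[|k]] m0 m_prim //; first by rewrite mulm0n eqxx in m0.
have /m_prim : (U_(i) *+ k.+2 = U_(i) + U_(i) *+ k.+1)%MM by rewrite mulmS.
have -> : U_(i)%MM = (U_(i) *+ 1)%MM :> 'X_{1..n} by rewrite mulm1n.
rewrite mon_char_mulm1 ai expr1n eqxx -!mdeg_eq0 !mdegMn mdeg1.
by move=> /(_ isT isT).
Qed.

Lemma aff_act_X (F : finFieldType) (n : nat) (A : GLpow F n) (i : 'I_n) :
  aff_act A 'X_i = (ul A i)%:MP * 'X_i + (ur A i)%:MP.
Proof. by rewrite /aff_act comp_mpolyXt tnth_mktuple. Qed.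

(** Otherwise the pure monomial at [k] would be a proper invariant factor of the atom. *)
Lemma mixed_atom_lt (F : finFieldType) (n : nat) (A : GLpow F n) (m : 'X_{1..n}) :
  (forall k, ul A k != 0) -> atom A m -> (forall k, m != pure_atom A k) ->
  forall k, (m k < ord_ul A k)%N.
Proof.
move=> a0 [m0 _ m_prim] m_mixed k; rewrite ltnNge; apply/negP => le_mk.
have le_pm : (pure_atom A k <= m)%MM.
  by apply/mnm_lepP=> j; rewrite pure_atomE; case: eqP => [<-|].
have [p0 pchi _] := atom_pure (a0 k).
have : mon_char A (pure_atom A k) != 1; last by rewrite pchi eqxx.
apply: (m_prim _ (m - pure_atom A k)%MM) => //; first by rewrite addmC submK.
apply: contraNneq (m_mixed k) => d0.
by rewrite -(submK le_pm) d0 addmC addm0.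
Qed.

Lemma free_pairwise_coprime (F : finFieldType) (n : nat) (A : GLpow F n) :
  reduced_type A -> is_free (fixed_ring A) -> pairwise_coprime_orders A.
Proof.
move=> A_red [m [s [s_ind s_gen]]] i j /eqP ne_ij; apply: contraT => not_cop.
have a0 k : ul A k != 0 by have [] := A_red k.
have [u [u_atom u_mixed]] := exists_mixed_atom a0 ne_ij not_cop.
have [p p_prime pF] := finPcharP F.
(* [None] indexes the mixed atom, added to the [n] pure ones. *)
pose mu (k : option 'I_n) := if k is Some k' then pure_atom A k' else u.
(* At a translated coordinate [x_k] is not fixed but [x_k - x_k ^ p] is; its coefficient at [x_k] is
   still 1, and [x_k ^ p] is not an atom, so duality with [mu] survives. *)
pose e (k : option 'I_n) : {mpoly F[n]} :=
  if k is Some k' then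
    if ur A k' == 0 then 'X_[pure_atom A k'] else 'X_k' - 'X_k' ^+ p
  else 'X_[u].
have mu_atom k : atom A (mu k) by case: k => [k|//]; apply: atom_pure.
have mu_inj : injective mu.
  move=> [k|] [l|] //= => [/pure_atom_inj->//|/eqP|/eqP]; last first.
    by rewrite (negPf (u_mixed l)).
  by rewrite eq_sym (negPf (u_mixed k)).
have ur_neq0 k : ur A k != 0 -> ul A k = 1 /\ ur A k = 1.
  by have [_ [->|//]] := A_red k; rewrite eqxx.
(* Such a monomial involves no translated variable, so [A] multiplies it by its character, which is
   1. *)
have X_fixed k : (forall l, ur A l != 0 -> mu k l = 0%N) ->
    'X_[mu k] \in fixed_ring A.
  move=> k_ur; apply/fixed_ringP; rewrite /aff_act comp_mpolyX.
  have [_ chi_k _] := mu_atom k.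
  rewrite -[RHS]scale1r -chi_k -mul_mpolyC mpolyXE_id rmorph_prod -big_split /=.
  apply: eq_bigr => l _; rewrite tnth_mktuple.
  have [-> | /k_ur->] := eqVneq (ur A l) 0; last by rewrite !expr0 mulr1.
  by rewrite mpolyC0 addr0 exprMn rmorphXn.
suff le_T : (#|{: option 'I_n}| <= m)%N.
  have := leq_trans le_T (alg_independent_leq s_ind).
  by rewrite card_option card_ord ltnn.
apply: (generates_card_leq (mu := mu) (e := e) s_gen).
- case=> [k|] /=; last first.
    (* The exponents of a mixed atom lie below the orders, hence vanish at translated coordinates,
       where the order is 1. *)
    apply: (X_fixed None) => l /ur_neq0[al _] /=.
    have := mixed_atom_lt a0 u_atom u_mixed l.
    by rewrite /ord_ul al mul_order1 ltnS leqn0 => /eqP.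
  case: ifP => [/eqP b0|/negbT/ur_neq0[ak bk]].
    apply: (X_fixed (Some k)) => l bl /=; rewrite pure_atomE; case: eqP => // kl.
    by rewrite -kl b0 eqxx in bl.
  apply/fixed_ringP; have := aff_act_X A k; rewrite /aff_act => XE.
  rewrite rmorphB rmorphXn /= XE ak bk mpolyC1 mul1r.
  have pM : p \in [pchar {mpoly F[n]}] by rewrite pchar_lalg.
  rewrite -!(pFrobenius_autE pM) pFrobenius_autD_comm; last exact: mulrC.
  by rewrite pFrobenius_aut1; ring.
- move=> k l; have -> : (k == l) = (mu k == mu l) by rewrite (inj_eq mu_inj).
  case: k => [k|] /=; last by rewrite mcoeffX.
  case: ifP => [_|/negbT/ur_neq0[ak bk]]; first by rewrite mcoeffX.
  rewrite mcoeffB mpolyXn !mcoeffX /pure_atom /ord_ul ak mul_order1 mulm1n.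
  suff /negPf-> : (U_(k) *+ p)%MM != mu l by rewrite subr0.
  apply/eqP => muE; have := mu_atom l; rewrite -muE => /(atom_U_eq1 ak) p1.
  by rewrite p1 in p_prime.
- by move=> k; have [] := mu_atom k.
- move=> k f m1 m2 fR muE m1_0 m2_0; apply/eqP; apply: contraT => fm1.
  have [_ _ /(_ _ _ muE m1_0 m2_0)] := mu_atom k.
  by rewrite (fixed_ring_mon_char A_red fR fm1) eqxx.
Qed.

(** * Coprime orders and minimal invariant monomials *)

Lemma pairwise_coprime_dvd (F : finFieldType) (n : nat) (A : GLpow F n)
    (m : 'X_{1..n}) : (forall i, ul A i != 0) ->
  pairwise_coprime_orders A -> mon_char A m = 1 ->
  forall i, (ord_ul A i %| m i)%N.
Proof.
(* Raising the character to the power [D] kills every factor but the [i]-th, and [D] is prime to the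
   order there. *)
move=> a0 cop chi_m i; pose D := (\prod_(j < n | j != i) ord_ul A j)%N.
have copD : coprime (ord_ul A i) D.
  rewrite /D; elim/big_rec: _ => [|j x ne_ji]; first exact: coprimen1.
  by rewrite coprimeMr => ->; rewrite cop // => ij; rewrite ij eqxx in ne_ji.
rewrite -(Gauss_dvdl _ copD) mul_order_dvd //.
have : mon_char A m ^+ D = 1 by rewrite chi_m expr1n.
rewrite /mon_char -prodrXl (bigD1 i) //= -exprM big1 ?mulr1 => [->//|j ne_ji].
apply/eqP; rewrite -exprM -mul_order_dvd // dvdn_mull //.
by rewrite /D (bigD1 j) //= dvdn_mulr.
Qed.

Lemma mon_char_restrict (F : finFieldType) (n : nat) (A : GLpow F n) (h : nat)
    (m : 'X_{1..n}) : (forall i : 'I_n, (h <= i)%N -> ul A i = 1) ->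
  \prod_(i < n | (i < h)%N) ul A i ^+ m i = mon_char A m.
Proof.
move=> a1; rewrite big_mkcond; apply: eq_bigr => i _.
by case: ltnP => // /a1->; rewrite expr1n.
Qed.

Lemma card_ord_lt (n h : nat) : (h <= n)%N -> #|[set i : 'I_n | (i < h)%N]| = h.
Proof.
move=> le_hn; rewrite -sum1_card; under eq_bigl do rewrite inE.
by rewrite -(big_ord_widen _ (fun=> 1%N)) // sum1_card card_ord.
Qed.

(** The [h] pure monomials always lie in [M_star], so the condition says that there are no others. A
    mixed atom would be another one; under coprimality every invariant monomial other than 1 is
    divisible by a pure one. *)
Lemma N_num_eq0P (F : finFieldType) (n : nat) (A : GLpow F n) (h : nat) :
  (h <= n)%N -> (forall i, ul A i != 0) ->
  (forall i : 'I_n, (i < h)%N = (ul A i != 1)) ->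
  N_num A h = 0 <-> pairwise_coprime_orders A.
Proof.
move=> le_hn a0 ltE.
have a1 (i : 'I_n) : (h <= i)%N -> ul A i = 1.
  by rewrite leqNgt ltE negbK => /eqP.
have M_atom (m : 'X_{1..n}) : atom A m -> (forall k, (m k <= ord_ul A k)%N) ->
    (forall k : 'I_n, (h <= k)%N -> m k = 0%N) -> in_M A h m.
  move=> [m0 chi_m _] m_le m_h; apply/and3P; split=> //.
    by apply/forallP=> k; case: ltnP => // /m_h->.
  by rewrite mon_char_restrict // chi_m.
have star_atom (m : 'X_{1..n < M_bound A h}) :
    atom A m -> in_M A h m -> m \in M_star A h.
  move=> [m0 _ m_prim] m_in; rewrite !inE m_in /=; apply/existsPn=> m'.
  apply/negP=> /and3P[]; rewrite inE => /and3P[m'0 _ chi_m'] ne_m' le_m'.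
  have := m_prim m' (m - m')%MM; rewrite mon_char_restrict // in chi_m'.
  rewrite addmC submK // chi_m' => /(_ erefl m'0).
  case: eqP => [d0 _|_ /(_ isT)//].
  by case/negP: ne_m'; rewrite -val_eqE /= -(submK le_m') d0 add0m.
have pure_in (i : 'I_n) : (i < h)%N -> in_M A h (pure_atom A i).
  move=> lt_ih; apply: M_atom; first exact: atom_pure.
    by move=> k; rewrite pure_atomE; case: eqP => [->|].
  move=> k le_hk; rewrite pure_atomE; case: eqP => // ik.
  by rewrite -ik leqNgt lt_ih in le_hk.
have bound0 : (mdeg (0%MM : 'X_{1..n}) < M_bound A h)%N by rewrite mdeg0.
pose pure (i : 'I_n) : 'X_{1..n < M_bound A h} :=
  insubd (BMultinom bound0) (pure_atom A i).
have pureE (i : 'I_n) : (i < h)%N -> bmnm (pure i) = pure_atom A i.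
  by move=> lt_ih; rewrite val_insubd in_M_bound // pure_in.
pose D := pure @: [set i : 'I_n | (i < h)%N].
have cardD : #|D| = h.
  rewrite card_in_imset ?card_ord_lt // => i j; rewrite !inE => lt_i lt_j pij.
  by apply: (@pure_atom_inj F n A); rewrite -!pureE ?pij.
have subD : D \subset M_star A h.
  apply/subsetP=> _ /imsetP[i + ->]; rewrite inE => lt_ih.
  by apply: star_atom; rewrite pureE //; [apply: atom_pure | apply: pure_in].
have N_eq0 : (N_num A h == 0) = (M_star A h \subset D).
  by rewrite /N_num subr_eq0 eqz_nat -[X in _ == X]cardD eq_sym (subset_leqif_cards subD)
    eqEsubset subD.
split=> [/eqP|cop]; rewrite ?N_eq0.
  move=> subM i j /eqP ne_ij; apply: contraT => not_cop.
  have [u [u_atom u_mixed]] := exists_mixed_atom a0 ne_ij not_cop.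
  have u_lt := mixed_atom_lt a0 u_atom u_mixed.
  have u_in : in_M A h u.
    apply: M_atom => // k; first exact: ltnW.
    move=> /a1 ak; have := u_lt k.
    by rewrite /ord_ul ak mul_order1 ltnS leqn0 => /eqP.
  have /(subsetP subM)/imsetP[k] :=
    star_atom (BMultinom (in_M_bound u_in)) u_atom u_in.
  rewrite inE => lt_kh /(congr1 val)/= uE; have := u_mixed k.
  by rewrite uE pureE ?eqxx.
apply/eqP; rewrite N_eq0; apply/subsetP=> m; rewrite !inE => /andP[m_in m_min].
have /and3P[m0 /forallP m_le chi_m] := m_in.
rewrite mon_char_restrict // in chi_m.
have m_dvd := pairwise_coprime_dvd a0 cop (eqP chi_m).
(* The nonzero exponent [m i] is a multiple of the order, so the pure monomial at [i] divides the
   minimal [m] and equals it. *)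
have [i mi] : exists i, m i != 0%N.
  apply/existsP; rewrite -negb_forall; apply: contraNN m0 => /forallP m_eq0.
  by apply/eqP/mnmP=> i; rewrite mnm0E; apply/eqP.
have lt_ih : (i < h)%N.
  by have := m_le i; case: ltnP => // _; rewrite leqn0 (negPf mi).
apply/imsetP; exists i; first by rewrite inE.
apply/eqP; apply: contraT => ne_m; case/negP: m_min; apply/existsP.
exists (pure i); rewrite !inE pureE // pure_in //= eq_sym ne_m /=.
apply/mnm_lepP=> k; rewrite pure_atomE; case: eqP => [<-|//].
by rewrite dvdn_leq // lt0n.
Qed.

(** * Replacing one variable by its norm in the expression of an invariant *)

Lemma horner_algE (R : nzRingType) (S : algType R) (z : S) (N : {poly R}) :
  horner_alg z N = (map_poly (in_alg S) N).[z].
Proof. by []. Qed.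

(* Reducing modulo the monic polynomial [N - N(y_k)] writes [f] as a polynomial
   in [y_k] of degree less than [size rs] whose coefficients are fixed by every
   substitution [u]; it then takes the value [f] at all elements of [rs], so it
   is constant. *)
Lemma fixed_poly_step (F : fieldType) (n : nat) (y : n.-tuple {mpoly F[n]})
    (k : 'I_n) (N : {poly F}) (f : {mpoly F[n]}) (rs : seq {mpoly F[n]}) :
  N \is monic -> (1 < size N)%N -> uniq rs -> (size N <= (size rs).+1)%N ->
  (forall z, z \in rs -> exists u : n.-tuple {mpoly F[n]},
     [/\ f \mPo u = f, forall i, i != k -> tnth y i \mPo u = tnth y i,
         tnth y k \mPo u = z & horner_alg z N = horner_alg (tnth y k) N]) ->
  (exists P, f = P \mPo y) ->
  exists Q, f = Q \mPo
    [tuple if i == k then horner_alg (tnth y k) N else tnth y i | i < n].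
Proof.
move=> N_monic N_size rs_uniq rs_size rs_u [P fE].
set y' := [tuple _ | i < n].
pose ev (Q : {poly {mpoly F[n]}}) := (map_poly (comp_mpoly y') Q).[tnth y k].
have evD Q Q' : ev (Q + Q') = ev Q + ev Q' by rewrite /ev rmorphD hornerD.
have evM Q Q' : ev (Q * Q') = ev Q * ev Q' by rewrite /ev rmorphM hornerM.
have evC q : ev q%:P = q \mPo y' by rewrite /ev map_polyC hornerC.
have ev1 : ev 1 = 1 by rewrite -[1]/(1%:P) evC comp_mpoly1.
have ev_y i : exists Q, ev Q = tnth y i.
  have [->|ne_ik] := eqVneq i k; first by exists 'X; rewrite /ev map_polyX hornerX.
  by exists ('X_i)%:P; rewrite evC comp_mpolyXt tnth_mktuple (negPf ne_ik).
have [Q0 Q0E] : exists Q, ev Q = f.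
  rewrite fE (mpolyE P) raddf_sum /=; elim/big_rec: _ => [|m q _ [Q <-]].
    by exists 0; rewrite -[0]/(0%:P) evC comp_mpoly0.
  rewrite comp_mpolyZ mpolyXE_id rmorph_prod /=.
  suff [Q' <-] : exists Q', ev Q' = \prod_i ('X_i ^+ m i \mPo y).
    by exists ((P@_m)%:MP%:P * Q' + Q); rewrite evD evM evC comp_mpolyC mul_mpolyC.
  elim/big_rec: _ => [|i q' _ [Q' <-]]; first by exists 1.
  rewrite rmorphXn /= comp_mpolyXt.
  have [Qi QiE] := ev_y i; exists (Qi ^+ m i * Q'); rewrite evM; congr (_ * _).
  by rewrite /ev rmorphXn horner_exp -/(ev Qi) QiE.
(* ['X_k] stands for the [k]-th entry [N(y_k)] of [y'], so [ev] sends this monic polynomial to 0. *)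
pose M : {poly {mpoly F[n]}} := map_poly (mpolyC n (R := F)) N - ('X_k)%:P.
have size_mapN : size (map_poly (mpolyC n (R := F)) N) = size N.
  exact: size_map_poly.
have sizeC_lt : (size (- ('X_k)%:P : {poly {mpoly F[n]}}) <
                 size (map_poly (mpolyC n (R := F)) N))%N.
  by rewrite size_polyN size_mapN (leq_ltn_trans (size_polyC_leq1 _)).
have size_M : size M = size N by rewrite /M size_polyDl.
have M_monic : M \is monic.
  by rewrite /M monicE lead_coefDl // lead_coef_map (monicP N_monic) rmorph1.
have horner_N z : horner_alg z N = (map_poly (mpolyC n (R := F)) N).[z].
  rewrite horner_algE; congr (_.[_]); apply: eq_map_poly => c.
  exact: alg_mpolyC.
have evM0 : ev M = 0.
  rewrite /ev rmorphB /= map_polyC -map_poly_comp hornerD hornerN hornerC /=.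
  rewrite comp_mpolyXt tnth_mktuple eqxx horner_N -(eq_map_poly (f := mpolyC n (R := F))).
    exact: subrr.
  by move=> c; rewrite /= comp_mpolyC.
pose Q1 := Pdiv.Ring.rmodp Q0 M; pose c := map_poly (comp_mpoly y') Q1.
have cE : c.[tnth y k] = f.
  rewrite -/(ev Q1) -Q0E (Pdiv.RingMonic.rdivp_eq M_monic Q0) evD evM evM0.
  by rewrite mulr0 add0r.
have size_c : (size c < size N)%N.
  apply: leq_ltn_trans (size_poly _ _) _; rewrite -size_M.
  by rewrite Pdiv.Ring.ltn_rmodpN0 // monic_neq0.
(* The coefficients of [c] are polynomials in [y'], whose entries [u] fixes; applying [u] to the
   value [f] at [y_k] gives the value at [z]. *)
have c_rs z : z \in rs -> c.[z] = f.
  move=> /rs_u[u [fu yu ykz Nz]].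
  have cu : map_poly (comp_mpoly u) c = c.
    apply/polyP=> j; rewrite !coef_map /= comp_mpolyA; apply: eq_comp_mpoly => i.
    rewrite tnth_mktuple [in RHS]tnth_mktuple tnth_mktuple.
    case: eqP => [_|/eqP ne_ik]; last exact: yu.
    rewrite [RHS](esym Nz) !horner_N -horner_map /= ykz -map_poly_comp; congr (_.[_]).
    by apply: eq_map_poly => a; rewrite /= comp_mpolyC.
  by rewrite -fu -[in RHS]cE -horner_map /= cu ykz.
have : c - f%:P = 0.
  apply: (roots_geq_poly_eq0 _ rs_uniq).
    by apply/allP=> z /c_rs cz; rewrite rootE !hornerE cz subrr.
  apply: leq_trans (size_polyD _ _) _; rewrite size_polyN geq_max -ltnS.
  rewrite (leq_trans size_c) //= -ltnS (leq_trans _ rs_size) //.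
  exact: leq_ltn_trans (size_polyC_leq1 _) N_size.
move/eqP; rewrite subr_eq0 => /eqP cf; exists Q1`_0.
by have := congr1 (fun q : {poly _} => q`_0) cf; rewrite coefC eqxx coef_map.
Qed.

(* Its value at [z] generates the invariants of [z |-> a z + b] when [b = 0] or
   [a = b = 1], the only cases considered. *)
Definition norm_poly (F : finFieldType) (p : nat) (a b : F) : {poly F} :=
  if b == 0 then 'X^(mul_order a) else 'X^p - 'X.

(** Besides the degree of [norm_poly], this is the order of the map [z |-> a z + b] in the two cases
    considered. *)
Definition norm_deg (F : finFieldType) (p : nat) (a b : F) : nat :=
  if b == 0 then mul_order a else p.

Section NormPoly.
Variables (F : finFieldType) (p : nat) (a b : F).
Hypotheses (pF : p \in [pchar F]) (a0 : a != 0)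
  (ab : b = 0 \/ a = 1 /\ b = 1).

Let p_gt1 : (1 < p)%N.
Proof. by case/andP: pF => /prime_gt1. Qed.

Lemma norm_deg_gt0 : (0 < norm_deg p a b)%N.
Proof. by rewrite /norm_deg; case: ifP => _; rewrite ?mul_order_gt0 ?(ltnW p_gt1). Qed.

Lemma size_norm_poly : size (norm_poly p a b) = (norm_deg p a b).+1.
Proof.
rewrite /norm_poly /norm_deg; case: ifP => _; first by rewrite size_polyXn.
by rewrite size_polyDl ?size_polyXn // size_polyN size_polyX ltnS.
Qed.

Lemma norm_poly_monic : norm_poly p a b \is monic.
Proof.
rewrite /norm_poly; case: ifP => _; first exact: monicXn.
by rewrite monicE lead_coefDl ?lead_coefXn // size_polyXn size_polyN size_polyX ltnS.
Qed.

Lemma horner_norm_poly (S : comAlgType F) (z : S) :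
  horner_alg z (norm_poly p a b) =
    if b == 0 then z ^+ mul_order a else z ^+ p - z.
Proof.
rewrite /norm_poly; case: ifP => _; first by rewrite rmorphXn /= horner_algX.
by rewrite rmorphB rmorphXn /= !horner_algX.
Qed.

(** A scaling factor disappears in the power [mul_order a]; a translation is by a multiple of 1,
    which the additive polynomial [z ^ p - z] sends to 0. *)
Lemma horner_norm_poly_affine (n m : nat) (z : {mpoly F[n]}) :
  horner_alg ((a ^+ m)%:MP * z + (b *+ m)%:MP) (norm_poly p a b) =
    horner_alg z (norm_poly p a b).
Proof.
rewrite !horner_norm_poly; case: (ab) => [->|[-> ->]].
  rewrite eqxx mul0rn mpolyC0 addr0 exprMn -rmorphXn /= -exprM mulnC exprM.
  by rewrite (prim_expr_order (mul_order_prim a0)) expr1n mpolyC1 mul1r.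
rewrite oner_eq0 expr1n mpolyC1 mul1r mpolyC_nat.
have pM : p \in [pchar {mpoly F[n]}] by rewrite pchar_lalg.
rewrite -!(pFrobenius_autE pM) pFrobenius_autD_comm; last exact: mulrC.
by rewrite pFrobenius_aut_nat; ring.
Qed.

(** The stride [c] is meant to be a product of degrees of other coordinates, so that iterates by
    multiples of [c] fix those; being prime to the degree here, it still runs through a full
    orbit. *)
Lemma affine_orbit_inj (n c l l' : nat) (z : {mpoly F[n]}) (m : 'X_{1..n}) :
  z@_m != 0 -> m != 0%MM -> coprime (norm_deg p a b) c ->
  (l < norm_deg p a b)%N -> (l' < norm_deg p a b)%N ->
  (a ^+ (l * c))%:MP * z + (b *+ (l * c))%:MP =
    (a ^+ (l' * c))%:MP * z + (b *+ (l' * c))%:MP -> l = l'.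
Proof.
move=> zm m0 cop_c.
wlog le_l : l l' / (l <= l')%N => [IH|lt_l lt_l' eq_orb].
  case/orP: (leq_total l l') => [/IH//|le_l lt_l lt_l' /esym eq_orb].
  by rewrite (IH _ _ le_l lt_l' lt_l eq_orb).
suff : (norm_deg p a b %| (l' - l) * c)%N.
  rewrite Gauss_dvdl // => l_dvd; apply/eqP; rewrite eqn_leq le_l leqNgt /=.
  apply/negP => lt_ll'; move: l_dvd; rewrite gtnNdvd ?subn_gt0 //.
  exact: leq_ltn_trans (leq_subr _ _) lt_l'.
have le_lc : (l * c <= l' * c)%N by rewrite leq_mul2r le_l orbT.
(* The coefficient at the nonconstant monomial [m] sees the scaling factors alone. *)
have eqa : a ^+ (l * c) = a ^+ (l' * c).
  have /= := congr1 (mcoeff m) eq_orb.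
  by rewrite !mcoeffD !mcoeffCM !mcoeffC (negPf m0) !mulr0 !addr0 => /(mulIf zm).
rewrite /norm_deg mulnBl; case: eqP => [b0|/eqP b_neq0].
  rewrite mul_order_dvd // -(inj_eq (mulfI (expf_neq0 (l * c) a0))).
  by rewrite -exprD subnKC // mulr1 eqa.
move: eq_orb; rewrite eqa => /addrI /eqP; rewrite mpolyC_eq.
case: (ab) => [b0|[_ ->]]; first by rewrite b0 eqxx in b_neq0.
by rewrite (dvdn_pcharf pF) natrB // subr_eq0 eq_sym.
Qed.

End NormPoly.

(** In characteristic [p] no primitive root of unity has order divisible by [p]. *)
Lemma norm_deg_coprime (F : finFieldType) (p : nat) (a : F) :
  p \in [pchar F] -> a != 0 -> coprime (norm_deg p a 0) p.
Proof.
move=> pF a0; rewrite /norm_deg eqxx coprime_sym prime_coprime; last by case/andP: pF.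
by apply/negP => /(prim_root_pcharF (mul_order_prim a0)); rewrite pF.
Qed.

(** Distinct monomials in the [g_i] have distinct leading monomials, so their leading terms cannot
    cancel. *)
Lemma mlead_alg_independent (F : fieldType) (n : nat) (g : n.-tuple {mpoly F[n]})
    (e : 'I_n -> nat) : (forall i, 0 < e i)%N ->
  (forall i, mlead (tnth g i) = U_(i) *+ e i)%MM -> alg_independent g.
Proof.
move=> e_gt0 g_lead P Pg0.
have g0 i : tnth g i != 0.
  apply: contraTneq (e_gt0 i) => gi0; have /mnmP/(_ i) := g_lead i.
  by rewrite gi0 mlead0 mnm0E mulmnE mnm1E eqxx mul1n => <-.
pose G (k : 'X_{1..n}) := P@_k *: \prod_i tnth g i ^+ k i.
pose phi (k : 'X_{1..n}) := [multinom (k i * e i)%N | i < n].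
have G_lead k : k \in msupp P -> mlead (G k) = phi k.
  rewrite mcoeff_msupp => Pk; rewrite mleadZ // mlead_prod; last first.
    by move=> i _ _; rewrite expf_neq0.
  apply/mnmP=> j; rewrite mnm_sumE mnmE (bigD1 j) //= big1 ?addn0.
    by rewrite mleadX // g_lead !mulmnE mnm1E eqxx mul1n mulnC.
  by move=> i ne_ij; rewrite mleadX // g_lead !mulmnE mnm1E (negPf ne_ij).
have phi_inj : injective phi.
  move=> k l /mnmP phi_kl; apply/mnmP=> i; have := phi_kl i; rewrite !mnmE.
  by move/eqP; rewrite eqn_pmul2r // => /eqP.
have G_uniq : uniq [seq mlead (G k) | k <- msupp P & xpredT k].
  rewrite filter_predT map_inj_in_uniq ?msupp_uniq // => k l kP lP.
  by rewrite !G_lead // => /phi_inj.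
(* The sum is 0, whose leading monomial is 0 by convention; as the maximum is 0, every term has
   leading monomial 0 and [P] is constant. *)
have := mlead_sum G_uniq; rewrite -comp_mpoly_prodX Pg0 mlead0 => lead0.
have P_supp k : k \in msupp P -> k = 0%MM.
  move=> kP; have /mnmP phi0 : phi k = 0%MM.
    apply/eqP; rewrite -mdeg_eq0 -leqn0 -[leqRHS](@mdeg0 n); apply: lemc_mdeg.
    rewrite [X in (_ <= X)%O]lead0 -G_lead //.
    exact: (Order.BJoinTheory.joins_sup_seq (fun k => mlead (G k))).
  apply/mnmP=> i; have := phi0 i; rewrite mnmE mnm0E => /eqP.
  by rewrite muln_eq0 => /orP[/eqP//|/eqP e0]; have := e_gt0 i; rewrite e0.
have PE : P = (P@_0)%:MP.
  apply/mpolyP=> k; rewrite mcoeffC; case: eqP => [->|k0]; first by rewrite mulr1.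
  by rewrite mulr0 memN_msupp_eq0 //; apply/negP => /P_supp.
by move: Pg0; rewrite PE comp_mpolyC.
Qed.

(** * Generators in the coprime case; [w] is a translated coordinate as soon as there is one *)

Section CoprimeGenerators.
Variables (F : finFieldType) (n : nat) (A : GLpow F n) (p : nat) (w : 'I_n).
Hypotheses (A_red : reduced_type A) (cop : pairwise_coprime_orders A)
  (pF : p \in [pchar F]) (w_ur : ur A w = 0 -> forall i, ur A i = 0).

(* In the coordinates [X_i - X_w], for the translated [X_i] other than [X_w],
   only [X_w] is translated. *)
Let kappa (i : 'I_n) : F := if i == w then 0 else ur A i.
Let beta (i : 'I_n) : F := if i == w then ur A i else 0.
Let v : n.-tuple {mpoly F[n]} := [tuple 'X_i - (kappa i)%:MP * 'X_w | i < n].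
Let v' : n.-tuple {mpoly F[n]} := [tuple 'X_i + (kappa i)%:MP * 'X_w | i < n].
Let orb (k : nat) : n.-tuple {mpoly F[n]} :=
  [tuple (ul A i ^+ k)%:MP * 'X_i + (ur A i *+ k)%:MP | i < n].

Let a0 (i : 'I_n) : ul A i != 0.
Proof. by have [] := A_red i. Qed.

Let kappaw : kappa w = 0.
Proof. by rewrite /kappa eqxx. Qed.

Let beta_type (i : 'I_n) : beta i = 0 \/ ul A i = 1 /\ beta i = 1.
Proof. by rewrite /beta; case: ifP => _; [have [] := A_red i | left]. Qed.

Let v'K (f : {mpoly F[n]}) : (f \mPo v') \mPo v = f.
Proof.
rewrite comp_mpolyA -[RHS]comp_mpoly_id; apply: eq_comp_mpoly => i.
rewrite !tnth_mktuple rmorphD rmorphM /= !comp_mpolyXt !tnth_mktuple comp_mpolyC.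
by rewrite kappaw mpolyC0; ring.
Qed.

Let vK (f : {mpoly F[n]}) : (f \mPo v) \mPo v' = f.
Proof.
rewrite comp_mpolyA -[RHS]comp_mpoly_id; apply: eq_comp_mpoly => i.
rewrite !tnth_mktuple rmorphB rmorphM /= !comp_mpolyXt !tnth_mktuple comp_mpolyC.
by rewrite kappaw mpolyC0; ring.
Qed.

Let v_orb (i : 'I_n) (k : nat) :
  tnth v i \mPo orb k = (ul A i ^+ k)%:MP * tnth v i + (beta i *+ k)%:MP.
Proof.
rewrite !tnth_mktuple rmorphB rmorphM /= !comp_mpolyXt !tnth_mktuple comp_mpolyC.
rewrite /beta; case: (eqVneq i w) => [->|ne_iw].
  by rewrite kappaw mpolyC0; ring.
rewrite /kappa (negPf ne_iw); have [_ [b0|[ai bi]]] := A_red i.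
  by rewrite b0 !mul0rn mpolyC0; ring.
(* [X_i] and [X_w] are both shifted by [k], so their difference is fixed; if [X_w] were not
   translated, [w_ur] would forbid translating [X_i]. *)
have [_ [b0|[aw bw]]] := A_red w; last first.
  by rewrite ai bi aw bw !expr1n !mul0rn mpolyC1 mpolyC0; ring.
by have := oner_neq0 F; rewrite -bi (w_ur b0 i) eqxx.
Qed.

Let orb_fixed (f : {mpoly F[n]}) (k : nat) : f \in fixed_ring A -> f \mPo orb k = f.
Proof.
by move=> /fixed_ringP fE; rewrite -iter_aff_act //; elim: k => //= k ->.
Qed.

Let N (i : 'I_n) := norm_poly p (ul A i) (beta i).
Let e (i : 'I_n) := norm_deg p (ul A i) (beta i).

(** This is what the change of variables is for: two translations would share the degree [p], but
    only [w] is still translated, and the order of a homothety is prime to [p]. *)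
Let e_coprime (i j : 'I_n) : i != j -> coprime (e i) (e j).
Proof.
move=> ne_ij; have e0 k : e k = if beta k == 0 then ord_ul A k else p by [].
have betaE k : beta k != 0 -> k = w
  by rewrite /beta; case: (eqVneq k w) => // _; rewrite eqxx.
have e_cop k l : beta k == 0 -> beta l != 0 -> coprime (e k) (e l).
  move=> bk bl; rewrite [e l]e0 (negPf bl) /e (eqP bk); exact: norm_deg_coprime.
have [bi|bi] := boolP (beta i == 0); have [bj|bj] := boolP (beta j == 0).
- by rewrite !e0 bi bj; apply/cop/eqP.
- exact: e_cop.
- by rewrite coprime_sym e_cop.
- by rewrite (betaE i) // (betaE j) // eqxx in ne_ij.
Qed.

Let v_orb_fixed (i : 'I_n) (k : nat) : (e i %| k)%N ->
  tnth v i \mPo orb k = tnth v i.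
Proof.
rewrite v_orb /e /norm_deg; have [->|[-> ->]] := beta_type i.
  rewrite eqxx mul_order_dvd // => /eqP->.
  by rewrite mul0rn mpolyC1 mpolyC0; ring.
rewrite oner_eq0 (dvdn_pcharf pF) => /eqP->.
by rewrite expr1n mpolyC1 mpolyC0; ring.
Qed.

Let v_coeff (i : 'I_n) : (tnth v i)@_U_(i) != 0.
Proof.
rewrite tnth_mktuple mcoeffB mcoeffCM !mcoeffXU eqxx /kappa [w == i]eq_sym.
by case: (i == w); rewrite ?mul0r ?mulr0 subr0 oner_neq0.
Qed.

(** Interpolates between the coordinates [v] at [k = 0] and the generators at [k = n]. *)
Let y (k : nat) : n.-tuple {mpoly F[n]} :=
  [tuple if (i < k)%N then horner_alg (tnth v i) (N i) else tnth v i | i < n].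

Let horner_comp (u : n.-tuple {mpoly F[n]}) (z : {mpoly F[n]}) (q : {poly F}) :
  horner_alg z q \mPo u = horner_alg (z \mPo u) q.
Proof.
rewrite !horner_algE -horner_map /= -map_poly_comp; congr (_.[_]).
by apply: eq_map_poly => c; rewrite /= comp_mpolyZ comp_mpoly1.
Qed.

Let N_orb (i : 'I_n) (k : nat) :
  horner_alg (tnth v i) (N i) \mPo orb k = horner_alg (tnth v i) (N i).
Proof. by rewrite horner_comp v_orb horner_norm_poly_affine. Qed.

Let fixed_y (f : {mpoly F[n]}) (k : nat) : (k <= n)%N ->
  f \in fixed_ring A -> exists P, f = P \mPo y k.
Proof.
move=> le_kn fA; elim: k le_kn => [_|k IH lt_kn].
  exists (f \mPo v'); rewrite -{1}(v'K f); apply: eq_comp_mpoly => i.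
  by rewrite [in RHS]tnth_mktuple.
(* A multiple of all the other [e i], so that [orb (l * c)] fixes the other coordinates, yet prime
   to [e j], so that [v_j] has [e j] distinct images. *)
pose j := Ordinal lt_kn; pose c := (\prod_(i < n | i != j) e i)%N.
have yj : tnth (y k) j = tnth v j by rewrite tnth_mktuple ltnn.
have cop_c : coprime (e j) c.
  rewrite /c; elim/big_rec: _ => [|i x ne_ij]; first exact: coprimen1.
  by rewrite coprimeMr => ->; rewrite e_coprime // eq_sym.
pose z l := (ul A j ^+ (l * c))%:MP * tnth v j + (beta j *+ (l * c))%:MP.
have z_inj : {in iota 0 (e j) &, injective z}.
  move=> l l'; rewrite !mem_iota !add0n /= => lt_l lt_l'.
  by apply: (affine_orbit_inj pF (a0 j) (beta_type j) (v_coeff j)) => //;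
    rewrite mnm1_eq0.
have [||||z0 /mapP[l]|Q fE] := fixed_poly_step (k := j) (N := N j) (f := f)
    (rs := [seq z l | l <- iota 0 (e j)]) _ _ _ _ _ (IH (ltnW lt_kn)).
- exact: norm_poly_monic.
- by rewrite size_norm_poly // ltnS norm_deg_gt0.
- by rewrite map_inj_in_uniq ?iota_uniq.
- by rewrite size_map size_iota size_norm_poly.
- move=> _ ->; exists (orb (l * c)); rewrite yj; split.
  + exact: orb_fixed.
  + move=> i ne_ij; rewrite tnth_mktuple; case: ifP => _; first exact: N_orb.
    by apply: v_orb_fixed; rewrite dvdn_mull // /c (bigD1 i) //= dvdn_mulr.
  + exact: v_orb.
  + exact: horner_norm_poly_affine.
exists Q; rewrite fE; apply: eq_comp_mpoly => i; rewrite !tnth_mktuple ltnS.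
rewrite [in RHS]leq_eqVlt -[(i == k :> nat)%N]/(i == j) ltnn.
by case: eqP => [->|].
Qed.

Lemma coprime_generators : exists s : n.-tuple {mpoly F[n]},
  alg_independent s /\ generates s (fixed_ring A).
Proof.
exists (y n); have yE i : tnth (y n) i = horner_alg (tnth v i) (N i).
  by rewrite tnth_mktuple ltn_ord.
split; last first.
  move=> f; split; first exact: fixed_y.
  move=> [P ->]; apply/fixed_ringP; rewrite -[aff_act A _]/(iter 1 (aff_act A) _).
  rewrite iter_aff_act // -/(orb 1) comp_mpolyA; apply: eq_comp_mpoly => i.
  by rewrite tnth_mktuple yE N_orb.
(* The invertible substitution [v] carries [g] to [y n], and the leading monomials of [g] are powers
   of distinct variables. *)
pose g : n.-tuple {mpoly F[n]} := [tuple horner_alg 'X_i (N i) | i < n].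
have g_ind : alg_independent g.
  apply: (@mlead_alg_independent F n g e) => i; first exact: norm_deg_gt0.
  rewrite tnth_mktuple horner_norm_poly /e /norm_deg; case: ifP => b0.
    by rewrite mpolyXn mleadXm.
  rewrite mpolyXn mleadDl; first by rewrite mleadXm.
  rewrite mleadN !mleadXm; apply: lt_mdeg_ltmc.
  by rewrite mdegMn mdeg1 mul1n; case/andP: pF => /prime_gt1.
move=> P Py0; apply: g_ind; rewrite -(vK (P \mPo g)) [_ \mPo v]comp_mpolyA.
rewrite (@eq_comp_mpoly _ _ _ _ (y n)) ?Py0 ?comp_mpoly0 // => i.
by rewrite yE !tnth_mktuple horner_comp comp_mpolyXt tnth_mktuple.
Qed.

End CoprimeGenerators.

(** * Free generators and isomorphisms with a polynomial ring *)

Section GeneratorsIsomorphism.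
Variables (F : finFieldType) (n : nat) (A : GLpow F n).
Variable s : n.-tuple {mpoly F[n]}.
Hypotheses (s_ind : alg_independent s) (s_gen : generates s (fixed_ring A)).

Let generators_polyP (f : fixed_alg A) :
  exists P : {mpoly F[n]}, fixed_val f == P \mPo s.
Proof. by have /s_gen[P fE] := fixed_valP f; exists P; rewrite fE. Qed.

(** Independence of [s] makes the chosen polynomial unique, hence the choice an algebra morphism. *)
Let coords (f : fixed_alg A) : {mpoly F[n]} := xchoose (generators_polyP f).

Let coordsK f : coords f \mPo s = fixed_val f.
Proof. exact/esym/eqP/(xchooseP (generators_polyP f)). Qed.

Let comp_s_inj : injective (comp_mpoly s).
Proof.
move=> P Q eqPQ; apply/eqP; rewrite -subr_eq0; apply/eqP/s_ind.
by rewrite rmorphB /= eqPQ subrr.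
Qed.

Let fixed_valE : @fixed_val F n A = val.
Proof. by []. Qed.

Let coords_linear : linear coords.
Proof.
move=> a f g; apply: comp_s_inj; rewrite comp_mpolyD comp_mpolyZ !coordsK.
by rewrite fixed_valE linearP.
Qed.

Let coords_monoid : monoid_morphism coords.
Proof.
split=> [|f g]; apply: comp_s_inj.
  by rewrite coordsK comp_mpoly1 fixed_valE rmorph1.
by rewrite rmorphM /= !coordsK fixed_valE rmorphM.
Qed.

HB.instance Definition _ :=
  GRing.isLinear.Build F (fixed_alg A) {mpoly F[n]} _ coords coords_linear.
HB.instance Definition _ :=
  GRing.isMonoidMorphism.Build (fixed_alg A) {mpoly F[n]} coords coords_monoid.

Lemma free_alg_isomorphic : alg_isomorphic (fixed_alg A) {mpoly F[n]}.
Proof.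
have sR P : P \mPo s \in fixed_ring A by apply/s_gen; exists P.
exists (coords : {lrmorphism fixed_alg A -> {mpoly F[n]}}).
exists (fun P => FixedAlg (sR P)) => [f|P]; first exact/val_inj/coordsK.
by apply: comp_s_inj; rewrite coordsK.
Qed.

End GeneratorsIsomorphism.

Lemma alg_isomorphic_free (F : finFieldType) (n m : nat) (A : GLpow F n) :
  alg_isomorphic (fixed_alg A) {mpoly F[m]} -> is_free (fixed_ring A).
Proof.
move=> [phi [psi phiK psiK]]; exists m, [tuple fixed_val (psi 'X_i) | i < m].
set s := [tuple _ | i < m].
have psi_comp P : fixed_val (psi P) = P \mPo s.
  (* [psi] is only given as an inverse map; its compatibility with the operations is checked through
     the injective morphism [phi]. *)
  have -> : psi P = \sum_(k <- msupp P) P@_k *: \prod_i psi 'X_i ^+ k i.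
    apply: (can_inj phiK); rewrite psiK raddf_sum {1}(mpolyE P) /=.
    apply: eq_bigr => k _; rewrite linearZ /= mpolyXE_id rmorph_prod.
    by congr (_ *: _); apply: eq_bigr => i _; rewrite rmorphXn /= psiK.
  pose L : {linear fixed_alg A -> {mpoly F[n]}} := (val : fixed_alg A -> {mpoly F[n]}).
  pose V : {rmorphism fixed_alg A -> {mpoly F[n]}} := (val : fixed_alg A -> {mpoly F[n]}).
  rewrite comp_mpoly_prodX -[LHS]/(L _) linear_sum; apply: eq_bigr => k _.
  rewrite linearZ; congr (_ *: _); rewrite -[LHS]/(V _) rmorph_prod.
  by apply: eq_bigr => i _; rewrite rmorphXn tnth_mktuple.
split=> [P|f].
  rewrite -psi_comp => P0; rewrite -(psiK P) (_ : psi P = 0) ?raddf0 //.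
  exact: val_inj.
split=> [fA|[P ->]]; last by rewrite -psi_comp; apply: fixed_valP.
by exists (phi (FixedAlg fA)); rewrite -psi_comp phiK.
Qed.

Lemma coprime_free (F : finFieldType) (n : nat) (A : GLpow F n) : (0 < n)%N ->
  reduced_type A -> pairwise_coprime_orders A ->
  exists s : n.-tuple {mpoly F[n]}, alg_independent s /\ generates s (fixed_ring A).
Proof.
move=> n_gt0 A_red cop; have [p _ pF] := finPcharP F.
(* Without translated coordinates the change of variables is trivial and any coordinate serves as
   [w]. *)
have [/existsP[w ur_w]|/existsPn ur0] := boolP [exists w, ur A w != 0].
  by apply: (coprime_generators (w := w) A_red cop pF) => w0; rewrite w0 eqxx in ur_w.
apply: (coprime_generators (w := Ordinal n_gt0) A_red cop pF) => _ i.
by apply/eqP; rewrite -[_ == _]negbK ur0.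
Qed.

Theorem theorem3p6 (F : finFieldType) (n : nat) (n_gt0 : (1 <= n)%N)
    (h t : nat) (A A1 A2 : GLpow F n)
    (A_in : A \in aff_pow F n)
    (A_type : has_type A h t)
    (A_dec : canonical_decomposition A h A1 A2) :
  [<-> is_free (fixed_ring A);
       h = 0%N \/ h = 1%N \/
         ((1 < h)%N /\
          forall i j : 'I_n, (i < h)%N -> (j < h)%N -> i <> j ->
            coprime (ord_ul A i) (ord_ul A j));
       N_num A1 h = 0;
       alg_isomorphic (fixed_alg A) {mpoly F[n]}].
Proof.
have [le_htn _] := A_type; have [A_red ltE] := has_type_reduced A_type.
have le_hn : (h <= n)%N := leq_trans (leq_addr t h) le_htn.
have a0 i : ul A i != 0 by have [] := A_red i.
(* Order 1 outside the homotheties lets coprimality range over all [n] coordinates and makes it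
   automatic for [h <= 1]. *)
have ord1 (i : 'I_n) : (i < h)%N = false -> ord_ul A i = 1%N.
  by rewrite ltE /ord_ul => /negbFE/eqP->; apply: mul_order1.
have copP : pairwise_coprime_orders A <-> h = 0%N \/ h = 1%N \/ ((1 < h)%N /\
    forall i j : 'I_n, (i < h)%N -> (j < h)%N -> i <> j ->
      coprime (ord_ul A i) (ord_ul A j)).
  split=> [cop|cop i j ne_ij].
    case: (h) => [|[|h']]; [by left | by right; left | right; right].
    by split=> // i j _ _; apply: cop.
  case lt_ih: (i < h)%N; last by rewrite (ord1 i) // coprime1n.
  case lt_jh: (j < h)%N; last by rewrite (ord1 j) // coprimen1.
  case: cop => [h0|[h1|[_ cop]]]; last exact: cop.
    by rewrite h0 in lt_ih.
  by case: ne_ij; apply: val_inj; rewrite h1 in lt_ih lt_jh; move: lt_ih lt_jh => /=; lia.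
(* From index [h] on both entries are 1, so [A1] and [A] have the same orders. *)
have ulA1 i : ul A1 i = ul A i.
  have [-> _] := A_dec; rewrite /ul ffunE; case: ifP => // lt_ih.
  move: (ltE i); rewrite lt_ih => /esym/negbFE/eqP.
  by rewrite /ul => ->; rewrite GL_1E mxE.
have N_copP : N_num A1 h = 0 <-> pairwise_coprime_orders A.
  have copA1 : pairwise_coprime_orders A1 <-> pairwise_coprime_orders A.
    by split=> cop i j /cop; rewrite /ord_ul !ulA1.
  have A1_0 i : ul A1 i != 0 by rewrite ulA1.
  have A1_lt (i : 'I_n) : (i < h)%N = (ul A1 i != 1) by rewrite ulA1.
  by rewrite (N_num_eq0P le_hn A1_0 A1_lt).
tfae.
- by move=> /(free_pairwise_coprime A_red)/copP.
- by move=> /copP/N_copP.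
- move=> /N_copP cop; have [s [s_ind s_gen]] := coprime_free n_gt0 A_red cop.
  exact: free_alg_isomorphic s_ind s_gen.
- exact: alg_isomorphic_free.
Qed.
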